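(* Let $n\ge 2$. The equivariant harmonic maps from $\mathbb{C}^n$ to $\mathbb{CP}^n$, that is, the solutions $u:[0,\infty)\to\mathbb{S}^2$ of $$0=u\times\left(u_{rr}+\frac{2n-1}{r}u_r+\frac{2n-2+u_3}{r^2}e_3\right),\quad r>0,\qquad u(0)=e_3,$$ are given explicitly, in the stereographic coordinate $f=(u_1+iu_2)/(1+u_3)$, by $f(r)=a r$ for $a\in\mathbb{C}$. More precisely, for each $a\in\mathbb{C}$ the unique solution with $f(0)=0$ and $f_r(0)=a$ is $f(r)=ar$; equivalently, in sphere coordinates, $$u(r)=\frac{1}{1+|a|^2r^2}\left(2\,\mathrm{Re}(a)\,r,\;2\,\mathrm{Im}(a)\,r,\;1-|a|^2r^2\right).$$
   Context: $\mathbb{S}^2\subset\mathbb{R}^3$ is the unit sphere, $e_3=(0,0,1)$, $u=(u_1,u_2,u_3)$, and $\times$ is the cross product. Solutions are understood to be $C^1$ on $[0,\infty)$ and $C^2$ on $(0,\infty)$. The stereographic projection $f=(u_1+iu_2)/(1+u_3)$ sends $e_3$ to $0$ and has inverse $u=\frac{1}{1+|f|^2}(2\,\mathrm{Re} f,2\,\mathrm{Im} f,1-|f|^2)$. In this reduction, an equivariant map $v:\mathbb{C}^n\to\mathbb{CP}^n$ is encoded by $u$ through $v(z)=\left[1+u_3(r),(u_1(r)+iu_2(r))\frac zr\right]$ (homogeneous coordinates), $r=|z|$. *)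

(* Defs.v *)
From HB Require Import structures.
From mathcomp Require Import all_boot all_order all_algebra.
From mathcomp Require Import all_classical all_reals all_analysis.
From mathcomp Require Export complex.

Set Implicit Arguments.
Unset Strict Implicit.
Unset Printing Implicit Defensive.

Import Order.TTheory GRing.Theory Num.Theory.
Import numFieldNormedType.Exports.


Local Open Scope classical_set_scope.
Local Open Scope complex_scope.
Local Open Scope ring_scope.

Section Vectors.
Context {R : realType}.
Implicit Types x y : 'rV[R]_3.

Definition vec3 (a b c : R) : 'rV[R]_3 := \row_(i < 3) [:: a; b; c]`_i.

(* The coordinates u_1, u_2, u_3 have the indices 0, 1, 2 of 'I_3. *)
Definition x1 x : R := x 0 0.
Definition x2 x : R := x 0 1.
Definition x3 x : R := x 0 2%:R.

Definition e3 : 'rV[R]_3 := vec3 0 0 1.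

Definition cross x y : 'rV[R]_3 :=
  vec3 (x2 x * x3 y - x3 x * x2 y)
       (x3 x * x1 y - x1 x * x3 y)
       (x1 x * x2 y - x2 x * x1 y).

(* The norm of the normed module 'rV[R]_3 is the sup norm, so the Euclidean
   unit sphere is written out. *)
Definition S2 : set 'rV[R]_3 := [set x | \sum_i x 0 i ^+ 2 = 1].

(* Meaningful only away from the south pole, that is for 1 + x3 x != 0. *)
Definition stereo x : R[i] := (x1 x +i* x2 x) / (1 + x3 x)%:C.

End Vectors.

Section HalfLine.
Context {R : realType}.

(* Functions on [0, oo[ are functions on R of which only the values at r >= 0
   matter; at 0 the derivative is one-sided. *)
Definition right_derive0 (V : normedModType R) (g : R -> V) (d : V) : Prop :=
  h^-1 *: (g h - g 0) @[h --> 0^'+] --> d.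

Definition C1_on_halfline (V : normedModType R) (g : R -> V) : Prop :=
  exists dg : R -> V,
    [/\ {within `[0, +oo[, continuous dg},
        right_derive0 g (dg 0)
      & forall r : R, 0 < r -> is_derive r 1 g (dg r)].

Definition C2_on_open_halfline (V : normedModType R) (g : R -> V) : Prop :=
  forall r : R, 0 < r ->
    [/\ derivable g r 1, derivable (derive1 g) r 1
      & {for r, continuous (derive1 (derive1 g))}].

(* R[i] carries no topology over R, so f_r(0) = a is read on the real and
   imaginary parts. *)
Definition complex_right_derive0 (f : R -> R[i]) (a : R[i]) : Prop :=
  right_derive0 (fun r => complex.Re (f r)) (complex.Re a) /\
  right_derive0 (fun r => complex.Im (f r)) (complex.Im a).

End HalfLine.

Section EquivariantHarmonicMaps.
Context {R : realType}.
Variable n : nat.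

Definition solution (u : R -> 'rV[R]_3) : Prop :=
  [/\ forall r : R, 0 <= r -> S2 (u r),
      C1_on_halfline u,
      C2_on_open_halfline u,
      u 0 = e3
    & forall r : R, 0 < r ->
        0 = cross (u r)
              (derive1 (derive1 u) r + ((2 * n - 1)%N%:R / r) *: derive1 u r
               + (((2 * n - 2)%N%:R + x3 (u r)) / r ^+ 2) *: e3)].

Definition solution_with_slope (a : R[i]) (u : R -> 'rV[R]_3) : Prop :=
  [/\ solution u, stereo (u 0) = 0 & complex_right_derive0 (stereo \o u) a].

(* "f(r) = a r for r >= 0", where f is the stereographic coordinate of u; this
   includes that u avoids the pole at which the coordinate is undefined. *)
Definition stereo_linear (a : R[i]) (u : R -> 'rV[R]_3) : Prop :=
  forall r : R, 0 <= r ->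
    [/\ S2 (u r), 1 + x3 (u r) != 0 & stereo (u r) = a * r%:C].

Definition explicit_u (a : R[i]) (r : R) : 'rV[R]_3 :=
  let b := complex.Re a ^+ 2 + complex.Im a ^+ 2 in
  (1 + b * r ^+ 2)^-1 *:
    vec3 (2 * complex.Re a * r) (2 * complex.Im a * r) (1 - b * r ^+ 2).

(* CP^n as the set of complex lines in C^(n+1). *)
Definition CP : Type := {L : {vspace 'rV[R[i]]_n.+1} | \dim L == 1%N}.

Definition Cnorm (z : 'rV[R[i]]_n) : R :=
  Num.sqrt (\sum_i (complex.Re (z 0 i) ^+ 2 + complex.Im (z 0 i) ^+ 2)).

(* v(z) = [1 + u3(r), (u1(r) + i u2(r)) z/r], r = |z|.  For z = 0 the inverse of
   0 is 0, which gives [1 + u3(0), 0]: the right point, since u(0) = e3. *)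
Definition encodes (u : R -> 'rV[R]_3) (v : 'rV[R[i]]_n -> CP) : Prop :=
  forall z : 'rV[R[i]]_n,
    let r := Cnorm z in
    val (v z) =
      <[row_mx ((1 + x3 (u r))%:C)%:M
               ((x1 (u r) +i* x2 (u r)) / r%:C *: z) : 'rV[R[i]]_(1 + n)]>%VS.

Definition equivariant_harmonic_map (v : 'rV[R[i]]_n -> CP) : Prop :=
  exists u, solution u /\ encodes u v.

End EquivariantHarmonicMaps.

(* Main.v *)
Require Import Defs.
From mathcomp Require Import all_boot all_order all_algebra.
From mathcomp Require Import all_classical all_reals all_analysis.
From mathcomp Require Import zify ring lra.

(* Put w = r u_r + e3 - u3 u, the defect of the first order equation that
   characterizes holomorphic equivariant maps.  The second order equation
   becomes linear and homogeneous for w: up to a normal component,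
   r w_r = - (2n - 2 + u3) w.  As 2n - 2 + u3 > 0 for n >= 2, |w|^2 is
   nonincreasing, and it tends to 0 at r = 0 because u is C^1 with u(0) = e3.
   So w = 0, that is r u_r = u3 u - e3.  Then r^2 (1 + u3) is nondecreasing,
   which keeps u away from the south pole, and u1 / (r (1 + u3)) and
   u2 / (r (1 + u3)) are constant, which is f = a r. *)

Set Implicit Arguments.
Unset Strict Implicit.
Unset Printing Implicit Defensive.

Import Order.TTheory GRing.Theory Num.Theory.
Import numFieldNormedType.Exports.

Local Open Scope classical_set_scope.
Local Open Scope complex_scope.
Local Open Scope ring_scope.

(** * Coordinates of vectors in R^3 *)

Section Coordinates.
Context {R : realType}.
Implicit Types x y : 'rV[R]_3.

Lemma vec3E (a b c : R) :
  (x1 (vec3 a b c) = a) * (x2 (vec3 a b c) = b) * (x3 (vec3 a b c) = c).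
Proof. by rewrite /x1 /x2 /x3 !mxE. Qed.

Lemma coord0 :
  (x1 (0 : 'rV[R]_3) = 0) * (x2 (0 : 'rV[R]_3) = 0) * (x3 (0 : 'rV[R]_3) = 0).
Proof. by rewrite /x1 /x2 /x3 !mxE. Qed.

Lemma coordD x y :
  (x1 (x + y) = x1 x + x1 y) * (x2 (x + y) = x2 x + x2 y)
  * (x3 (x + y) = x3 x + x3 y).
Proof. by rewrite /x1 /x2 /x3 !mxE. Qed.

Lemma coordN x :
  (x1 (- x) = - x1 x) * (x2 (- x) = - x2 x) * (x3 (- x) = - x3 x).
Proof. by rewrite /x1 /x2 /x3 !mxE. Qed.

Lemma coordZ (a : R) x :
  (x1 (a *: x) = a * x1 x) * (x2 (a *: x) = a * x2 x)
  * (x3 (a *: x) = a * x3 x).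
Proof. by rewrite /x1 /x2 /x3 !mxE. Qed.

Definition coordE := (coord0, coordD, coordN, coordZ, vec3E).

End Coordinates.

(** The cases are the ring numerals of ['I_3] that [x1], [x2] and [x3] use, so each of them matches
    a projection by conversion. *)
Lemma ord3P (P : 'I_3 -> Prop) : P 0 -> P 1 -> P 2%:R -> forall i, P i.
Proof.
move=> P0 P1 P2 [[|[|[|//]]] h].
- by rewrite (_ : Ordinal h = 0) //; apply: val_inj.
- by rewrite (_ : Ordinal h = 1) //; apply: val_inj.
- by rewrite (_ : Ordinal h = 2%:R) //; apply: val_inj.
Qed.

Lemma row3_eq (R : realType) (x y : 'rV[R]_3) :
  x1 x = x1 y -> x2 x = x2 y -> x3 x = x3 y -> x = y.
Proof. by move=> e1 e2 e3; apply/rowP; apply: ord3P. Qed.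

Lemma S2E (R : realType) (x : 'rV[R]_3) :
  S2 x <-> x1 x ^+ 2 + x2 x ^+ 2 + x3 x ^+ 2 = 1.
Proof.
rewrite /S2 /= !big_ord_recl big_ord0 addr0 addrA /x1 /x2 /x3.
rewrite (_ : lift ord0 ord0 = 1 :> 'I_3); last exact: val_inj.
by rewrite (_ : lift ord0 (lift ord0 ord0) = 2%:R :> 'I_3); last exact: val_inj.
Qed.

(** * Entrywise derivatives and limits *)

Lemma is_derive_mxP (R : realFieldType) (V : normedModType R) m n
    (M : V -> 'M[R]_(m, n)) (D : 'M[R]_(m, n)) t v :
  is_derive t v M D <-> forall i j, is_derive t v (fun x => M x i j) (D i j).
Proof.
split=> [[dM <-] i j|dM].
  apply: DeriveDef; first exact: (iffLR (derivable_mxP M t v)).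
  by rewrite derive_mx// mxE.
have dbl : derivable M t v by apply/derivable_mxP => i j; apply: ex_derive.
apply: DeriveDef => //; apply/matrixP => i j; rewrite derive_mx// mxE.
exact: derive_val.
Qed.

Lemma cvg_mx_coord (R : realType) (T : Type) (F : set_system T)
    m n (M : T -> 'M[R]_(m, n)) (L : 'M[R]_(m, n)) i j :
  M t @[t --> F] --> L -> M t i j @[t --> F] --> L i j.
Proof.
move=> ML; apply: (@cvg_comp _ _ _ M (fun A : 'M[R]_(m, n) => A i j) _ _ _ ML).
exact: coord_continuous.
Qed.

(** * Monotonicity on the open half-line *)

Lemma ge0_derive_nondecr (R : realType) (g : R -> R) :
  (forall r : R, 0 < r -> exists2 d : R, is_derive r 1 g d & 0 <= d) ->
  forall s r : R, 0 < s -> s <= r -> g s <= g r.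
Proof.
move=> Dg s r s0 sr.
have gt0 t : t \in `[s, r]%R -> 0 < t.
  by rewrite in_itv/= => /andP[+ _]; exact: lt_le_trans.
have oc : {subset `]s, r[%R <= `[s, r]%R} by exact: subset_itv_oo_cc.
apply: (@ger0_derive1_le_cc _ g s r); rewrite ?in_itv/= ?lexx ?sr//.
- by move=> t /oc/gt0/Dg[d dgt _]; exact: ex_derive.
- by move=> t /oc/gt0/Dg[d dgt d0]; rewrite derive1E derive_val.
- apply/continuous_in_subspaceT => t /set_mem/gt0/Dg[d dgt _].
  by apply/differentiable_continuous/derivable1_diffP; exact: ex_derive.
Qed.

Lemma le0_derive_nonincr (R : realType) (g : R -> R) :
  (forall r : R, 0 < r -> exists2 d : R, is_derive r 1 g d & d <= 0) ->
  forall s r : R, 0 < s -> s <= r -> g r <= g s.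
Proof.
move=> Dg s r s0 sr; rewrite -lerN2.
apply: (@ge0_derive_nondecr _ (fun t => - g t)) => // t /Dg[d dgt d0].
by exists (- d); [exact: is_deriveN|rewrite oppr_ge0].
Qed.

Lemma derive0_const (R : realType) (g : R -> R) :
  (forall r : R, 0 < r -> is_derive r 1 g 0) ->
  forall s r : R, 0 < s -> 0 < r -> g s = g r.
Proof.
move=> Dg s r s0 r0.
wlog sr : s r s0 r0 / s <= r.
  by move=> H; case: (leP s r) => [|/ltW] sr; [|symmetry]; exact: H.
by apply/le_anti/andP; split; [apply: ge0_derive_nondecr|
  apply: le0_derive_nonincr] => // t /Dg; exists 0.
Qed.

(** * Algebra of the second order equation *)

Lemma parallel_of_cross0 (F : comPzRingType) (x y z a b c : F) :
  x ^+ 2 + y ^+ 2 + z ^+ 2 = 1 ->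
  y * c - z * b = 0 -> z * a - x * c = 0 -> x * b - y * a = 0 ->
  let l := x * a + y * b + z * c in [/\ a = l * x, b = l * y & c = l * z].
Proof.
move=> S X Y Z l; split.
(* Each component is read off the triple product expansion |x|^2 a = (x . a) x - x × (x × a), with
   |x| = 1. *)
- rewrite -[LHS]mulr1 -S (_ : _ * _ =
    l * x + z * (z * a - x * c) - y * (x * b - y * a)); last
    by rewrite /l; ring.
  by rewrite Y Z; ring.
- rewrite -[LHS]mulr1 -S (_ : _ * _ =
    l * y + x * (x * b - y * a) - z * (y * c - z * b)); last
    by rewrite /l; ring.
  by rewrite X Z; ring.
- rewrite -[LHS]mulr1 -S (_ : _ * _ =
    l * z + y * (y * c - z * b) - x * (z * a - x * c)); last
    by rewrite /l; ring.
  by rewrite X Y; ring.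
Qed.

(* With k = 2n - 2, the a_i are the components of the vector crossed with u in
   the equation and the left-hand side is half the derivative of |w|^2. *)
Lemma defect_energy_ode (F : fieldType) (k r u1 u2 u3 p1 p2 p3 q1 q2 q3 : F) :
  r != 0 ->
  u1 ^+ 2 + u2 ^+ 2 + u3 ^+ 2 = 1 ->
  u1 * p1 + u2 * p2 + u3 * p3 = 0 ->
  let a1 := q1 + (k + 1) / r * p1 in
  let a2 := q2 + (k + 1) / r * p2 in
  let a3 := q3 + (k + 1) / r * p3 + (k + u3) / r ^+ 2 in
  u2 * a3 - u3 * a2 = 0 -> u3 * a1 - u1 * a3 = 0 -> u1 * a2 - u2 * a1 = 0 ->
  let w1 := r * p1 - u3 * u1 in
  let w2 := r * p2 - u3 * u2 in
  let w3 := r * p3 + 1 - u3 * u3 in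
  w1 * (p1 + r * q1 - (p3 * u1 + u3 * p1))
  + w2 * (p2 + r * q2 - (p3 * u2 + u3 * p2))
  + w3 * (p3 + r * q3 - (p3 * u3 + u3 * p3))
  = - ((k + u3) / r * (w1 ^+ 2 + w2 ^+ 2 + w3 ^+ 2)).
Proof.
move=> r0 S T a1 a2 a3 X Y Z w1 w2 w3.
have [] := @parallel_of_cross0 F u1 u2 u3 a1 a2 a3 S X Y Z.
set l := (u1 * _ + _ + _) => e1 e2 e3.
(* The vector crossed with u equals l u for a multiplier l, which allows the second derivative q to
   be eliminated. *)
have q1E : q1 = l * u1 - (k + 1) / r * p1 by rewrite -e1 /a1; ring.
have q2E : q2 = l * u2 - (k + 1) / r * p2 by rewrite -e2 /a2; ring.
have q3E : q3 = l * u3 - (k + 1) / r * p3 - (k + u3) / r ^+ 2.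
  by rewrite -e3 /a3; ring.
(* w is tangent to the sphere: r p is tangent, and e3 - u3 u is the tangential projection of e3. *)
have wu : w1 * u1 + w2 * u2 + w3 * u3 = 0.
  rewrite (_ : _ + _ = r * (u1 * p1 + u2 * p2 + u3 * p3)
    + u3 * (1 - (u1 ^+ 2 + u2 ^+ 2 + u3 ^+ 2))); last
    by rewrite /w1 /w2 /w3; ring.
  by rewrite S T; ring.
(* Substituting q and p + e3 / r = (w + u3 u) / r gives w_r = (r l - p3 - u3 (k + u3) / r) u - (k +
   u3) / r w; this is its scalar product with w, where the term along u drops out. *)
rewrite (_ : _ + _ = (r * l - p3 - u3 * (k + u3) / r)
   * (w1 * u1 + w2 * u2 + w3 * u3)
   - (k + u3) / r * (w1 ^+ 2 + w2 ^+ 2 + w3 ^+ 2)).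
  by rewrite wu; ring.
rewrite q1E q2E q3E; clearbody l.
rewrite /w1 /w2 /w3; field.
exact: r0.
Qed.

(** * The defect w along a solution *)

Lemma is_derive_x1 (R : realType) (u : R -> 'rV[R]_3) (d : 'rV[R]_3) (r : R) :
  is_derive r 1 u d -> is_derive r 1 (x1 \o u) (x1 d).
Proof. by move=> /is_derive_mxP; apply. Qed.

Lemma is_derive_x2 (R : realType) (u : R -> 'rV[R]_3) (d : 'rV[R]_3) (r : R) :
  is_derive r 1 u d -> is_derive r 1 (x2 \o u) (x2 d).
Proof. by move=> /is_derive_mxP; apply. Qed.

Lemma is_derive_x3 (R : realType) (u : R -> 'rV[R]_3) (d : 'rV[R]_3) (r : R) :
  is_derive r 1 u d -> is_derive r 1 (x3 \o u) (x3 d).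
Proof. by move=> /is_derive_mxP; apply. Qed.

Lemma sphere_tangent (R : realType) (u du : R -> 'rV[R]_3) :
  (forall r : R, 0 < r -> S2 (u r)) ->
  (forall r : R, 0 < r -> is_derive r 1 u (du r)) ->
  forall r : R, 0 < r ->
  x1 (u r) * x1 (du r) + x2 (u r) * x2 (du r) + x3 (u r) * x3 (du r) = 0.
Proof.
move=> Su Du r r0.
have D1 := is_derive_x1 (Du r r0).
have D2 := is_derive_x2 (Du r r0).
have D3 := is_derive_x3 (Du r r0).
have D := is_deriveD (is_deriveD (is_deriveM D1 D1) (is_deriveM D2 D2))
  (is_deriveM D3 D3).
set N := (X in is_derive _ _ X _) in D.
have /near_eq_derive : \near r, N r = cst 1 r.
  near=> t; rewrite /N /= !fctE -!expr2; apply/S2E/Su.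
  by near: t; exact: lt_nbhsr.
move=> /(_ 1); rewrite derive_cst (@derive_val _ _ _ _ _ _ _ D) /GRing.scale/=.
by lra.
Unshelve. all: by end_near. Qed.

(** The derivative is a separate argument because [derive1 u] is two-sided and so uncontrolled at 0,
    where the limit of w is needed. *)
Definition defect {R : realType} (u du : R -> 'rV[R]_3) (r : R) : 'rV[R]_3 :=
  r *: du r + e3 - x3 (u r) *: u r.

Definition defect_energy {R : realType} (u du : R -> 'rV[R]_3) (r : R) : R :=
  x1 (defect u du r) ^+ 2 + x2 (defect u du r) ^+ 2 + x3 (defect u du r) ^+ 2.

(** Replaces [derive1 u] by the derivative [du] of the C^1 hypothesis, which is right-continuous at
    0; the two agree for r > 0, hence so do their derivatives. *)
Lemma solution_derivatives (R : realType) n (u : R -> 'rV[R]_3) :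
  solution n u ->
  exists du : R -> 'rV[R]_3, [/\ du r @[r --> 0^'+] --> du 0,
    u r @[r --> 0^'+] --> e3,
    forall r : R, 0 < r -> derive1 u r = du r,
    forall r : R, 0 < r -> is_derive r 1 u (du r)
  & forall r : R, 0 < r -> is_derive r 1 du (derive1 (derive1 u) r)].
Proof.
case=> Su [du [cdu du0 Du]] C2 u0 _; exists du.
have E (r : R) : 0 < r -> derive1 u r = du r.
  by move=> r0; rewrite derive1E (@derive_val _ _ _ _ _ _ _ (Du r r0)).
split => //.
- have /continuous_within_itvcyP [_] := cdu; exact.
- rewrite -u0.
  (* Right continuity of u at 0 follows from the one-sided derivative: u h is u 0 plus h times a
     convergent difference quotient. *)
  have : u 0 + h *: (h^-1 *: (u h - u 0)) @[h --> 0^'+] --> u 0 + 0 *: du 0.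
    apply: cvgD; first exact: cvg_cst.
    apply: cvgZ => //.
    exact: cvg_at_right_filter.
  rewrite scale0r addr0; apply: cvg_trans; apply: near_eq_cvg; near=> h.
  by rewrite scalerA divff ?scale1r ?subrKC.
- move=> r r0; have [_ dd _] := C2 r r0.
  apply: (@near_eq_is_derive _ _ _ (derive1 u)).
    by near=> t; apply: E; near: t; exact: lt_nbhsr.
  by rewrite derive1E; exact: derivableP.
Unshelve. all: by end_near. Qed.

Lemma S2_x3_geN1 (R : realType) (x : 'rV[R]_3) : S2 x -> -1 <= x3 x.
Proof.
by move=> /S2E S; have := sqr_ge0 (x1 x); have := sqr_ge0 (x2 x); nra.
Qed.

Lemma cvg_x1 (R : realType) (T : Type) (F : set_system T)
    (u : T -> 'rV[R]_3) (l : 'rV[R]_3) :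
  u t @[t --> F] --> l -> x1 (u t) @[t --> F] --> x1 l.
Proof. exact: cvg_mx_coord. Qed.

Lemma cvg_x2 (R : realType) (T : Type) (F : set_system T)
    (u : T -> 'rV[R]_3) (l : 'rV[R]_3) :
  u t @[t --> F] --> l -> x2 (u t) @[t --> F] --> x2 l.
Proof. exact: cvg_mx_coord. Qed.

Lemma cvg_x3 (R : realType) (T : Type) (F : set_system T)
    (u : T -> 'rV[R]_3) (l : 'rV[R]_3) :
  u t @[t --> F] --> l -> x3 (u t) @[t --> F] --> x3 l.
Proof. exact: cvg_mx_coord. Qed.

(** The initial condition enters here: r u_r tends to 0 because u_r has a finite limit, and e3 - u3
    u tends to e3 - e3. *)
Lemma cvg_defect (R : realType) (u du : R -> 'rV[R]_3) :
  du r @[r --> 0^'+] --> du 0 -> u r @[r --> 0^'+] --> e3 ->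
  defect u du r @[r --> 0^'+] --> (0 : 'rV[R]_3).
Proof.
move=> cdu cu.
rewrite (_ : 0 = (0 : R) *: du 0 + e3 - x3 (e3 : 'rV[R]_3) *: e3); last first.
  by rewrite vec3E scale0r add0r scale1r subrr.
apply: cvgB; last by apply: cvgZ => //; exact: cvg_x3.
apply: cvgD; last exact: cvg_cst.
by apply: cvgZ => //; exact: cvg_at_right_filter.
Qed.

Lemma cvg_defect_energy (R : realType) (u du : R -> 'rV[R]_3) :
  du r @[r --> 0^'+] --> du 0 -> u r @[r --> 0^'+] --> e3 ->
  defect_energy u du r @[r --> 0^'+] --> (0 : R).
Proof.
move=> cdu cu; have cw := cvg_defect cdu cu.
have c1 : x1 (defect u du r) @[r --> 0^'+] --> (0 : R).
  by rewrite -[X in _ --> X]coord0.1.1; exact: cvg_x1.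
have c2 : x2 (defect u du r) @[r --> 0^'+] --> (0 : R).
  by rewrite -[X in _ --> X]coord0.1.2; exact: cvg_x2.
have c3 : x3 (defect u du r) @[r --> 0^'+] --> (0 : R).
  by rewrite -[X in _ --> X]coord0.2; exact: cvg_x3.
have := cvgD (cvgD (cvgM c1 c1) (cvgM c2 c2)) (cvgM c3 c3).
by rewrite !mulr0 !addr0 => cE; exact: cE.
Qed.

Lemma is_derive_defect (R : realType) (u du : R -> 'rV[R]_3)
    (ddu : 'rV[R]_3) (r : R) :
  is_derive r 1 u (du r) -> is_derive r 1 du ddu ->
  is_derive r 1 (defect u du)
    (du r + r *: ddu - (x3 (du r) *: u r + x3 (u r) *: du r)).
Proof.
move=> Du Ddu; apply/is_derive_mxP => i j.
have /is_derive_mxP/(_ i j) Dij := Du.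
have /is_derive_mxP/(_ i j) Ddij := Ddu.
have D3 := is_derive_x3 Du.
have D := is_deriveB (is_deriveD (is_deriveM (is_derive_id r 1) Ddij)
   (is_derive_cst (e3 i j) r 1)) (is_deriveM D3 Dij).
rewrite (_ : (fun x => _) = id * (fun t => du t i j) + cst (e3 i j)
   - (x3 \o u) * (fun t => u t i j)); last first.
  by apply/funext => t; rewrite /= !fctE /defect !mxE.
by apply: is_derive_eq; rewrite !mxE /GRing.scale/=; ring.
Qed.

(** The derivative is - 2 (k + u3) / r |w|^2 with k = 2n - 2, so the claim comes down to the sign of
    k + u3. *)
Lemma defect_energy_le0 (R : realType) n (u du : R -> 'rV[R]_3) (r : R) :
  (2 <= n)%N -> solution n u -> 0 < r ->
  (forall r : R, 0 < r -> is_derive r 1 u (du r)) ->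
  (forall r : R, 0 < r -> derive1 u r = du r) ->
  (forall r : R, 0 < r -> is_derive r 1 du (derive1 (derive1 u) r)) ->
  exists2 e : R, is_derive r 1 (defect_energy u du) e & e <= 0.
Proof.
move=> n2 [Su _ _ _ eqn] r0 Du uE Ddu.
have {}Su s : 0 < s -> S2 (u s) by move=> s0; apply: Su; exact: ltW.
have Dw := is_derive_defect (Du r r0) (Ddu r r0).
have D1 := is_derive_x1 Dw.
have D2 := is_derive_x2 Dw.
have D3 := is_derive_x3 Dw.
have D := is_deriveD (is_deriveD (is_deriveM D1 D1) (is_deriveM D2 D2))
  (is_deriveM D3 D3).
eexists; first exact: D.
(* Both subtractions are truncated in the naturals; n >= 2 makes them genuine. *)
have kE : (2 * n - 1)%N%:R = (2 * n - 2)%N%:R + 1 :> R.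
  by rewrite natr1; congr _%:R; lia.
(* Together with u3 >= -1 on the sphere, this makes k + u3 positive. *)
have k2 : 2 <= (2 * n - 2)%N%:R :> R by rewrite (ler_nat _ 2); lia.
have := eqn r r0; rewrite (uE r r0) kE => X.
have := congr1 x3 X; have := congr1 x2 X; have := congr1 x1 X.
rewrite /cross !coordE !(mulr0, mulr1, addr0) => X1 X2 X3.
have E := defect_energy_ode (lt0r_neq0 r0) (iffLR (S2E (u r)) (Su r r0))
  (sphere_tangent Su Du r0) (esym X1) (esym X2) (esym X3).
rewrite /= /defect /GRing.scale/= !coordE !(mulr0, mulr1, addr0).
(* The product rule yields every term twice; [E] evaluates one copy. *)
rewrite -!mulr2n -!mulrnDl E.
rewrite pmulrn_lle0// oppr_le0 mulr_ge0//.
  rewrite divr_ge0 ?(ltW r0)//.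
  by have := S2_x3_geN1 (Su r r0); lra.
by rewrite !addr_ge0 ?sqr_ge0.
Qed.

(** A positive value g r would bound g from below on (0, r], against the limit 0. *)
Lemma cvg0_nonincr_le0 (R : realType) (g : R -> R) :
  g r @[r --> 0^'+] --> (0 : R) ->
  (forall s r : R, 0 < s -> s <= r -> g r <= g s) ->
  forall r : R, 0 < r -> g r <= 0.
Proof.
move=> g0 gmono r r0; rewrite leNgt; apply/negP => gr0.
near (0 : R)^'+ => s.
have : g s < g r by near: s; exact: cvgr_lt g0 _ gr0.
by apply/negP; rewrite -leNgt gmono//; near: s; exact: nbhs_right_le.
Unshelve. all: by end_near. Qed.

(** Away from the south pole, r u_r = u3 u - e3 reads r f_r = f in the stereographic coordinate,
    whose solutions are f = a r. *)
Lemma solution_first_order (R : realType) n (u : R -> 'rV[R]_3) :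
  (2 <= n)%N -> solution n u ->
  forall r : R, 0 < r -> exists2 d : 'rV[R]_3, is_derive r 1 u d &
    r *: d = x3 (u r) *: u r - e3.
Proof.
move=> n2 sol r r0.
have [du [cdu cu uE Du Ddu]] := solution_derivatives sol.
exists (du r); first exact: Du.
have E0 : defect_energy u du r <= 0.
  apply: cvg0_nonincr_le0 r0; first exact: cvg_defect_energy.
  apply: le0_derive_nonincr => s s0.
  exact: (defect_energy_le0 n2 sol).
suff w0 : defect u du r = 0.
  by apply/eqP; rewrite -subr_eq0 opprB addrA -[X in X == _]/(defect u du r) w0.
move: E0; rewrite /defect_energy => E0.
have z1 := sqr_ge0 (x1 (defect u du r)).
have z2 := sqr_ge0 (x2 (defect u du r)).
have z3 := sqr_ge0 (x3 (defect u du r)).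
by apply: row3_eq; rewrite [RHS]mxE; apply/eqP; rewrite -sqrf_eq0 eq_le; lra.
Qed.

(** * Integration of the first order equation *)

Section FirstOrderEquation.
Context {R : realType} (u : R -> 'rV[R]_3).
Hypothesis u_first_order : forall r : R, 0 < r ->
  exists2 d : 'rV[R]_3, is_derive r 1 u d & r *: d = x3 (u r) *: u r - e3.
Hypothesis cvg_u : u r @[r --> 0^'+] --> e3.

(** On the sphere 1 + u3 itself is nonincreasing, as r u3' = u3^2 - 1 <= 0. The weight r^2
    compensates: the derivative of r^2 (1 + u3) is r (1 + u3)^2. *)
Lemma first_order_south_pole (r : R) : 0 < r -> 0 < 1 + x3 (u r).
Proof.
move=> r0.
have mono : forall s t : R, 0 < s -> s <= t ->
    s ^+ 2 * (1 + x3 (u s)) <= t ^+ 2 * (1 + x3 (u t)).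
  apply: (@ge0_derive_nondecr _ (fun t => t ^+ 2 * (1 + x3 (u t)))) => t t0.
  have [d Du dE] := u_first_order t0; have D3 := is_derive_x3 Du.
  have D := is_deriveM (is_deriveX 2 (is_derive_id t 1))
    (is_deriveD (is_derive_cst (1 : R) t 1) D3).
  eexists; first exact: D.
  have := congr1 x3 dE; rewrite !coordE /GRing.scale/= => d3.
  rewrite add0r -[(cst 1 + _) t]/(1 + x3 (u t)) fctE /=.
  rewrite [X in 0 <= X](_ : _ = t * (1 + x3 (u t)) ^+ 2); last first.
    have -> : x3 d = (x3 (u t) * x3 (u t) - 1) / t.
      by rewrite -d3 mulrC mulKf// lt0r_neq0.
    by field; rewrite lt0r_neq0.
  by rewrite mulr_ge0 ?sqr_ge0 ?ltW.
(* Since u3 tends to 1, the weighted quantity is positive at some small s, and monotonicity carries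
   this to r. *)
near (0 : R)^'+ => s.
have s0 : 0 < s by [].
have sr : s <= r by near: s; exact: nbhs_right_le.
have us : 0 < x3 (u s).
  by near: s; apply: cvgr_gt (cvg_x3 cvg_u) _ _; rewrite vec3E.
have := mulr_gt0 (exprn_gt0 2 s0) (ltr_wpDl ler01 us).
by move=> /lt_le_trans/(_ (mono s r s0 sr)); rewrite pmulr_rgt0 ?exprn_gt0.
Unshelve. all: by end_near. Qed.

(** Treats [x1] and [x2] together: e3 vanishes in both coordinates, so each satisfies r x' = u3 x.
    Then x / (r (1 + u3)) has derivative 0, and its constant value is taken at r = 1. *)
Lemma first_order_ratio (x : 'rV[R]_3 -> R) :
  (forall (r : R) (d : 'rV[R]_3),
     is_derive r 1 u d -> is_derive r 1 (x \o u) (x d)) ->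
  (forall (r : R) (d : 'rV[R]_3),
     r *: d = x3 (u r) *: u r - e3 -> r * x d = x3 (u r) * x (u r)) ->
  forall r : R, 0 < r ->
  x (u r) = x (u 1) / (1 + x3 (u 1)) * r * (1 + x3 (u r)).
Proof.
move=> Dx xE r r0; have pos := first_order_south_pole.
have Dratio (t : R) : 0 < t ->
    is_derive t 1 (fun t => x (u t) * (t * (1 + x3 (u t)))^-1) 0.
  move=> t0.
  have [d Du dE] := u_first_order t0; have D3 := is_derive_x3 Du.
  have nz : t * (1 + x3 (u t)) != 0 by rewrite mulf_neq0 ?lt0r_neq0 ?pos.
  have DV := @is_deriveV _ (id * (cst 1 + x3 \o u)) _ _ _ nz
    (is_deriveM (is_derive_id t 1)
      (is_deriveD (is_derive_cst (1 : R) t 1) D3)).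
  apply: is_derive_eq (is_deriveM (Dx _ _ Du) DV) _.
  have := congr1 x3 dE; have := xE _ _ dE; rewrite !coordE => d1 d3.
  have t0' := lt0r_neq0 t0.
  rewrite add0r /GRing.scale/= !fctE.
  have -> : x d = x3 (u t) * x (u t) / t by rewrite -d1 mulrC mulKf.
  have -> : x3 d = (x3 (u t) * x3 (u t) - 1) / t by rewrite -d3 mulrC mulKf.
  by field; rewrite t0' lt0r_neq0 ?pos.
have := derive0_const Dratio ltr01 r0; rewrite mul1r => ->.
by rewrite -mulrA divfK// mulf_neq0 ?lt0r_neq0 ?pos.
Qed.

End FirstOrderEquation.

Lemma solution_stereo_linear (R : realType) n (u : R -> 'rV[R]_3) :
  (2 <= n)%N -> solution n u -> exists a : R[i], stereo_linear a u.
Proof.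
move=> n2 sol; have F := solution_first_order n2 sol.
have [_ [_ cu _ _ _]] := solution_derivatives sol.
case: sol => Su _ _ u0 _.
have pos := first_order_south_pole F cu; have ratio := first_order_ratio F cu.
(* As f(r) = a r, the slope is a = f(1). *)
exists ((x1 (u 1) / (1 + x3 (u 1))) +i* (x2 (u 1) / (1 + x3 (u 1)))).
move=> r; rewrite le_eqVlt => /predU1P[<-|r0].
  split; first exact: Su.
  - by rewrite u0 vec3E lt0r_neq0// addr_gt0.
  - by rewrite u0 /stereo !vec3E mulr0 mul0r.
have p := lt0r_neq0 (pos r r0).
split=> //; first exact: Su (ltW r0).
have pC : (1 + x3 (u r))%:C != 0 by rewrite (fmorph_eq0 (real_complex R)).
apply: (mulIf pC); rewrite /stereo divfK//.
have e1 : x1 (u r) = x1 (u 1) / (1 + x3 (u 1)) * r * (1 + x3 (u r)).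
  apply: ratio r0 => [s d|s d /(congr1 x1)]; first exact: is_derive_x1.
  by rewrite !coordE subr0.
have e2 : x2 (u r) = x2 (u 1) / (1 + x3 (u 1)) * r * (1 + x3 (u r)).
  apply: ratio r0 => [s d|s d /(congr1 x2)]; first exact: is_derive_x2.
  by rewrite !coordE subr0.
apply/eqP; rewrite eq_complex /= !(mulr0, mul0r, subr0, addr0, add0r).
by rewrite e1 e2 !eqxx.
Qed.

(** * Invariance under changes at negative r *)

Section HalfLineTransfer.
Context {R : realType} {V : normedModType R}.
Implicit Types u v : R -> V.

Lemma near_eq_continuous_at u v (r : R) :
  (\forall t \near r, u t = v t) ->
  {for r, continuous u} -> {for r, continuous v}.
Proof.
move=> uv cu; have := nbhs_singleton uv; rewrite /prop_for /continuous_at => <-.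
by apply: cvg_trans cu; exact: near_eq_cvg.
Qed.

Lemma near_eq_on_halfline u v :
  (forall r : R, 0 < r -> u r = v r) ->
  forall r : R, 0 < r -> \forall t \near r, u t = v t.
Proof.
by move=> uv r r0; near=> t; apply: uv; near: t; exact: lt_nbhsr.
Unshelve. all: by end_near. Qed.

Lemma eq_derive1_on_halfline u v :
  (forall r : R, 0 < r -> u r = v r) ->
  forall r : R, 0 < r -> derive1 u r = derive1 v r.
Proof.
move=> uv r r0; rewrite !derive1E.
exact/near_eq_derive/near_eq_on_halfline.
Qed.

Lemma eq_C1_on_halfline u v : (forall r : R, 0 <= r -> u r = v r) ->
  C1_on_halfline u -> C1_on_halfline v.
Proof.
move=> uv [du [cdu du0 Du]]; exists du; split=> //.
  apply: cvg_trans du0; apply: near_eq_cvg; near=> h.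
  by rewrite !uv.
move=> r r0; apply: near_eq_is_derive (Du r r0).
by apply: near_eq_on_halfline => // t /ltW/uv.
Unshelve. all: by end_near. Qed.

Lemma eq_C2_on_open_halfline u v : (forall r : R, 0 < r -> u r = v r) ->
  C2_on_open_halfline u -> C2_on_open_halfline v.
Proof.
move=> uv C2 r r0; have d1 := eq_derive1_on_halfline uv.
have [e1 e2 c] := C2 r r0; split.
- exact: near_eq_derivable (near_eq_on_halfline uv r0) e1.
- exact: near_eq_derivable (near_eq_on_halfline d1 r0) e2.
- apply: near_eq_continuous_at c.
  exact: (near_eq_on_halfline (eq_derive1_on_halfline d1)).
Qed.

End HalfLineTransfer.

(** A solution is constrained only at r >= 0, whereas functions live on all of R; this lets
    [explicit_u] stand for every function that agrees with it there. *)
Lemma eq_solution (R : realType) n (u v : R -> 'rV[R]_3) :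
  (forall r : R, 0 <= r -> u r = v r) -> solution n u -> solution n v.
Proof.
move=> uv [Su C1 C2 u0 eqn].
have uv0 r : 0 < r -> u r = v r by move=> /ltW/uv.
have d1 := eq_derive1_on_halfline uv0.
have d2 := eq_derive1_on_halfline d1.
split.
- by move=> r r0; rewrite -uv//; exact: Su.
- exact: eq_C1_on_halfline C1.
- exact: eq_C2_on_open_halfline C2.
- by rewrite -uv.
- by move=> r r0; rewrite -d2// -d1// -uv0//; exact: eqn.
Qed.

(** * Curves with rational components *)

Section RationalCurve.
Context {R : realType} (q : {poly R}).
Hypothesis q_neq0 : forall r : R, q.[r] != 0.

(** Keeping powers of one fixed q as denominators makes the class closed under differentiation, so
    smoothness comes for free and derivatives reduce to polynomial computations on the
    numerators. *)
Definition rational_curve m (k : nat) (p : 'I_m -> {poly R}) (r : R) :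
  'rV[R]_m :=
  \row_j ((p j).[r] * q.[r] ^- k).

(* (p / q^k)' = (p' q - k p q') / q^(k+1) *)
Definition rational_curve_deriv m (k : nat) (p : 'I_m -> {poly R}) (j : 'I_m) :=
  (p j)^`() * q - k%:R *: (p j * q^`()).

Lemma is_derive_rational_curve m k (p : 'I_m -> {poly R}) (r : R) :
  is_derive r 1 (rational_curve k p)
    (rational_curve k.+1 (rational_curve_deriv k p) r).
Proof.
apply/is_derive_mxP => i j.
have DV := is_deriveV (q_neq0 r) (is_derive_poly q r).
have D := is_deriveM (is_derive_poly (p j) r) (is_deriveX k DV).
rewrite (_ : (fun _ => _) = horner (p j) * (fun t => q.[t]^-1) ^+ k);
  last first.
  by apply/funext => t; rewrite mxE mulrfctE exprfctE exprVn.
apply: is_derive_eq D _.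
rewrite mxE /rational_curve_deriv !hornerE /GRing.scale/= exprfctE.
(* The power rule involves the exponent k - 1, truncated at k = 0; there its factor k kills the
   term. *)
case: k => [|k] /=; first by rewrite !mul0r !mulr0 expr0 add0r expr1; field.
rewrite !exprVn !exprS; have := q_neq0 r.
have : q.[r] ^+ k != 0 by rewrite expf_neq0.
by move=> qk q0; field; rewrite qk.
Qed.

Lemma derive1_rational_curve m k (p : 'I_m -> {poly R}) :
  derive1 (rational_curve k p) = rational_curve k.+1 (rational_curve_deriv k p).
Proof.
apply/funext => r; rewrite derive1E.
by have D := is_derive_rational_curve k p r; exact: derive_val.
Qed.

Lemma continuous_rational_curve m k (p : 'I_m -> {poly R}) :
  continuous (rational_curve k p).
Proof.
move=> r; apply/differentiable_continuous/derivable1_diffP.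
by have D := is_derive_rational_curve k p r; exact: ex_derive.
Qed.

End RationalCurve.

(** * The explicit curve solves the equation *)

Section ExplicitSolution.
Context {R : realType} (a : R[i]).

Let b : R := complex.Re a ^+ 2 + complex.Im a ^+ 2.

Definition explicit_denominator : {poly R} := 1 + b *: 'X^2.

Definition explicit_numerator (j : 'I_3) : {poly R} :=
  [:: (2 * complex.Re a) *: 'X; (2 * complex.Im a) *: 'X; 1 - b *: 'X^2]`_j.

Lemma explicit_denominatorE r : explicit_denominator.[r] = 1 + b * r ^+ 2.
Proof. by rewrite /explicit_denominator !hornerE. Qed.

Lemma explicit_denominator_gt0 r : 0 < 1 + b * r ^+ 2.
Proof.
by rewrite ltr_wpDr// mulr_ge0 ?sqr_ge0// addr_ge0 ?sqr_ge0.
Qed.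

Lemma explicit_denominator_neq0 r : explicit_denominator.[r] != 0.
Proof.
by rewrite explicit_denominatorE lt0r_neq0// explicit_denominator_gt0.
Qed.

Lemma explicit_uE :
  explicit_u a = rational_curve explicit_denominator 1 explicit_numerator.
Proof.
apply/funext => r; apply/rowP; apply: ord3P;
rewrite !mxE/= explicit_denominatorE expr1 [LHS]mulrC; congr (_ / _);
by rewrite !hornerE.
Qed.

Lemma explicit_u_S2 r : S2 (explicit_u a r).
Proof.
apply/S2E; rewrite /explicit_u -/b !coordE.
have := lt0r_neq0 (explicit_denominator_gt0 r); rewrite /b.
by move=> h; field.
Qed.

Lemma derive1_explicit_u r : derive1 (explicit_u a) r =
  (1 + b * r ^+ 2) ^- 2 *: vec3 (2 * complex.Re a * (1 - b * r ^+ 2))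
    (2 * complex.Im a * (1 - b * r ^+ 2)) (- (4 * b * r)).
Proof.
rewrite explicit_uE (derive1_rational_curve explicit_denominator_neq0).
apply/rowP; apply: ord3P;
  rewrite !mxE/= explicit_denominatorE [LHS]mulrC; congr (_ * _);
  rewrite /rational_curve_deriv /explicit_numerator /explicit_denominator/=
    !(poly.derivE, hornerD, hornerN, hornerZ, hornerM, hornerX,
      hornerXn, hornerMn, hornerC);
  ring.
Qed.

Lemma derive1_2_explicit_u r : derive1 (derive1 (explicit_u a)) r =
  (1 + b * r ^+ 2) ^- 3 *:
    vec3 (2 * complex.Re a * (2 * b ^+ 2 * r ^+ 3 - 6 * b * r))
      (2 * complex.Im a * (2 * b ^+ 2 * r ^+ 3 - 6 * b * r))
      (- (4 * b * (1 - 3 * b * r ^+ 2))).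
Proof.
rewrite explicit_uE !(derive1_rational_curve explicit_denominator_neq0).
apply/rowP; apply: ord3P;
  rewrite !mxE/= explicit_denominatorE [LHS]mulrC; congr (_ * _);
  rewrite /rational_curve_deriv /explicit_numerator /explicit_denominator/=
    !(poly.derivE, hornerD, hornerN, hornerZ, hornerM, hornerX,
      hornerXn, hornerMn, hornerC);
  ring.
Qed.

Lemma is_derive_right_derive0 (V : normedModType R) (g : R -> V) (d : V) :
  is_derive (0 : R) 1 g d -> right_derive0 g d.
Proof.
case=> dg <-; apply: cvg_dnbhs_at_right.
(* Brings h into the form h * 1 + 0 of the directional difference quotient at 0. *)
under eq_fun do rewrite -[X in g X - _]addr0 -[X in X + 0]mulr1.
exact: dg.
Qed.

Lemma explicit_u_solution n : (0 < n)%N -> solution n (explicit_u a).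
Proof.
move=> n0; pose D := explicit_denominator_neq0.
split.
- by move=> r _; exact: explicit_u_S2.
- rewrite explicit_uE.
  exists (rational_curve explicit_denominator 2
    (rational_curve_deriv explicit_denominator 1 explicit_numerator)); split.
  + exact/continuous_subspaceT/continuous_rational_curve.
  (* The denominator is positive on all of R, so the curve is differentiable at 0 from both sides
     and the right derivative is the ordinary one. *)
  + have [df dE] := is_derive_rational_curve D 1 explicit_numerator 0.
    apply: is_derive_right_derive0.
    exact: is_derive_rational_curve.
  + by move=> r _; exact: is_derive_rational_curve.
- rewrite explicit_uE => r r0; split.
  + have D1 := is_derive_rational_curve D 1 explicit_numerator r.
    exact: ex_derive.
  + rewrite (derive1_rational_curve D).
    have D2 := is_derive_rational_curve D 2
      (rational_curve_deriv explicit_denominator 1 explicit_numerator) r.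
    exact: ex_derive.
  + by rewrite !(derive1_rational_curve D); exact: continuous_rational_curve.
- by apply: row3_eq;
    rewrite /explicit_u !coordE ?(expr0n, mulr0, subr0, addr0, mulr1, invr1).
- move=> r r0.
  rewrite derive1_2_explicit_u derive1_explicit_u /explicit_u -/b.
  have r_neq0 := lt0r_neq0 r0.
  have den := lt0r_neq0 (explicit_denominator_gt0 r).
  have -> : (2 * n - 1)%N%:R = (2 * n - 2)%N%:R + 1 :> R.
    by rewrite natr1; congr _%:R; lia.
  (* The equation holds for every real k: the coefficient of k is u_r / r + e3 / r^2 = u3 u / r^2,
     which is parallel to u. *)
  move: (2 * n - 2)%N%:R => k.
  apply: row3_eq; rewrite /cross !coordE; rewrite /b in den *.
  + by field; rewrite r_neq0.
  + by field; rewrite r_neq0.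
  + by field; rewrite r_neq0.
Qed.

End ExplicitSolution.

(** * Stereographic coordinate and its inverse *)

Lemma addr1_x3_explicit_u (R : realType) (a : R[i]) (r : R) :
  1 + x3 (explicit_u a r) =
  2 / (1 + (complex.Re a ^+ 2 + complex.Im a ^+ 2) * r ^+ 2).
Proof.
rewrite /explicit_u !coordE.
by have den := lt0r_neq0 (explicit_denominator_gt0 a r); field.
Qed.

Lemma addr1_x3_explicit_u_neq0 (R : realType) (a : R[i]) (r : R) :
  1 + x3 (explicit_u a r) != 0.
Proof.
rewrite addr1_x3_explicit_u mulf_neq0 ?pnatr_eq0// invr_eq0 lt0r_neq0//.
exact: explicit_denominator_gt0.
Qed.

(** Clears the complex denominator, leaving two real equations suited to [field]. *)
Lemma stereoP (R : realType) (x : 'rV[R]_3) (z : R[i]) : 1 + x3 x != 0 ->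
  stereo x = z <->
  x1 x = complex.Re z * (1 + x3 x) /\ x2 x = complex.Im z * (1 + x3 x).
Proof.
move=> p; have pC : (1 + x3 x)%:C != 0 by rewrite (fmorph_eq0 (real_complex R)).
case: z => y z; split=> [E|[E1 E2]].
  have := congr1 (fun t => t * (1 + x3 x)%:C) E; rewrite /stereo divfK//.
  move/eqP; rewrite eq_complex /= !(mulr0, subr0, add0r).
  by move=> /andP[/eqP-> /eqP->].
apply: (mulIf pC); rewrite /stereo divfK//; apply/eqP.
by rewrite eq_complex /= !(mulr0, subr0, add0r) E1 E2 !eqxx.
Qed.

Lemma stereo_explicit_u (R : realType) (a : R[i]) (r : R) :
  stereo (explicit_u a r) = a * r%:C.
Proof.
apply/stereoP; first exact: addr1_x3_explicit_u_neq0.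
rewrite addr1_x3_explicit_u /explicit_u !coordE; case: a => a1 a2 /=.
have /= den := lt0r_neq0 (explicit_denominator_gt0 (a1 +i* a2) r).
by split; field.
Qed.

Lemma stereo_linear_explicit_u (R : realType) (a : R[i]) (u : R -> 'rV[R]_3) :
  stereo_linear a u <-> forall r : R, 0 <= r -> u r = explicit_u a r.
Proof.
split=> [lin r r0|uE r r0]; last first.
  rewrite uE//; split; [exact: explicit_u_S2|exact: addr1_x3_explicit_u_neq0|].
  exact: stereo_explicit_u.
have [/S2E S p /(stereoP _ p) [e1 e2]] := lin r r0.
have den := lt0r_neq0 (explicit_denominator_gt0 a r).
case: a e1 e2 {lin} den => a1 a2 /=.
rewrite !(mulr0, subr0, add0r) => e1 e2 den.
(* Inverse stereographic projection: (1 + u3)^2 (1 + |f|^2) = (1 + u3)^2 + u1^2 + u2^2 = 2 (1 + u3)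
   on the sphere, and 1 + u3 cancels. *)
have p3 : 1 + x3 (u r) = 2 / (1 + (a1 ^+ 2 + a2 ^+ 2) * r ^+ 2).
  apply: (mulIf den); apply: (mulfI p); rewrite divfK//.
  move: S; rewrite e1 e2 => S.
  rewrite (_ : _ * (_ * _) = (a1 * r * (1 + x3 (u r))) ^+ 2
    + (a2 * r * (1 + x3 (u r))) ^+ 2 + x3 (u r) ^+ 2 + 1 + 2 * x3 (u r));
    last by ring.
  by rewrite S; ring.
apply: row3_eq; rewrite /explicit_u !coordE /=.
- by rewrite e1 p3; ring.
- by rewrite e2 p3; ring.
- by apply: (addrI 1); rewrite p3; field.
Qed.

Lemma linear_right_derive0 (R : realType) (c : R) (g : R -> R) :
  (forall r : R, 0 <= r -> g r = c * r) -> right_derive0 g c.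
Proof.
move=> gE; have : cst c h @[h --> (0 : R)^'+] --> c by exact: cvg_cst.
apply: cvg_trans; apply: near_eq_cvg; near=> h.
by rewrite /= !gE// mulr0 subr0 /GRing.scale/= mulrC mulfK.
Unshelve. all: by end_near. Qed.

Lemma stereo_linear_slope (R : realType) (a : R[i]) (u : R -> 'rV[R]_3) :
  stereo_linear a u -> complex_right_derive0 (stereo \o u) a.
Proof.
move=> lin; split; apply: linear_right_derive0 => r /lin[_ _ E];
    rewrite [(_ \o _) r]/= E.
  by case: a {lin E} => a1 a2 /=; rewrite mulr0 subr0.
by case: a {lin E} => a1 a2 /=; rewrite mulr0 add0r.
Qed.

Lemma complex_right_derive0_unique (R : realType) (f : R -> R[i]) (a b : R[i]) :
  complex_right_derive0 f a -> complex_right_derive0 f b -> a = b.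
Proof.
case=> ra ia [rb ib]; apply/eqP; rewrite eq_complex.
apply/andP; split; apply/eqP.
  exact: cvg_unique ra rb.
exact: cvg_unique ia ib.
Qed.

(** * Maps into projective space *)

Lemma exists_encodes (R : realType) n (u : R -> 'rV[R]_3) :
  (forall r : R, 0 <= r -> 1 + x3 (u r) != 0) ->
  exists v : 'rV[R[i]]_n -> CP (R := R) n, encodes u v.
Proof.
move=> p.
pose w (z : 'rV[R[i]]_n) : 'rV[R[i]]_(1 + n) :=
  row_mx ((1 + x3 (u (Cnorm z)))%:C)%:M
    ((x1 (u (Cnorm z)) +i* x2 (u (Cnorm z))) / (Cnorm z)%:C *: z).
(* The first homogeneous coordinate 1 + u3 is nonzero off the south pole, so the span is a line also
   at z = 0. *)
have w_neq0 z : w z != 0.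
  apply/eqP => /(congr1 lsubmx); rewrite row_mxKl linear0.
  move=> /matrixP/(_ 0 0)/eqP; rewrite !mxE mulr1n.
  by rewrite (fmorph_eq0 (real_complex R)); apply/negP/p; exact: sqrtr_ge0.
have dim1 z : \dim <[w z]>%VS == 1%N by rewrite dim_vline w_neq0.
exists (fun z => exist (fun L => is_true (\dim L == 1%N)) <[w z]>%VS (dim1 z)).
by [].
Qed.

Lemma encodes_eq (R : realType) n (u u' : R -> 'rV[R]_3)
    (v : 'rV[R[i]]_n -> CP (R := R) n) :
  (forall r : R, 0 <= r -> u r = u' r) -> encodes u v -> encodes u' v.
Proof.
by move=> uu' uv z; rewrite /= -uu' ?sqrtr_ge0//; exact: uv.
Qed.

Theorem mainTheorem4 (R : realType) (n : nat) (hn : (2 <= n)%N) :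
  [/\ (forall u : R -> 'rV[R]_3,
         solution n u <-> exists a : R[i], stereo_linear a u),
      (forall v : 'rV[R[i]]_n -> CP (R := R) n,
         equivariant_harmonic_map v <->
         exists a : R[i], encodes (explicit_u a) v)
    & forall a : R[i],
        [/\ solution_with_slope n a (explicit_u a),
            (forall u : R -> 'rV[R]_3, solution_with_slope n a u ->
               forall r : R, 0 <= r -> u r = explicit_u a r),
            (forall u : R -> 'rV[R]_3,
               stereo_linear a u <->
               forall r : R, 0 <= r -> u r = explicit_u a r)
          & exists v : 'rV[R[i]]_n -> CP (R := R) n,
              encodes (explicit_u a) v]].
Proof.
have sol a : solution n (@explicit_u R a).
  by apply: explicit_u_solution; exact: ltnW.
have lin a : stereo_linear a (@explicit_u R a) 
  by apply/stereo_linear_explicit_u.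
split=> [u|v|a].
- split=> [|[a /stereo_linear_explicit_u uE]].
    exact: solution_stereo_linear.
  by apply: eq_solution (sol a) => r r0; rewrite uE.
- split=> [[u [su uv]]|[a av]]; last by exists (explicit_u a).
  have [a /stereo_linear_explicit_u uE] := solution_stereo_linear hn su.
  by exists a; exact: encodes_eq uv.
- split.
  + split; [exact: sol| |exact: stereo_linear_slope].
    by rewrite stereo_explicit_u mulr0.
  (* The solution is linear with some slope a'; uniqueness of the right derivative at 0 identifies
     a' with a. *)
  + move=> u [su _ slope]; apply/stereo_linear_explicit_u.
    have [a' lin'] := solution_stereo_linear hn su.
    by rewrite (complex_right_derive0_unique slope (stereo_linear_slope lin')).
  + by move=> u; exact: stereo_linear_explicit_u.
  + by apply: exists_encodes => r _; exact: addr1_x3_explicit_u_neq0.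
Qed.
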